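(* For every integer $r\ge5$, \[ f_{r-1}(r+1,r)=\rho_{r-1}\big(T(r+2,r)\big)=\frac{4r-4}{r+2}. \]
   Context: $\mathcal{G}(\Delta,\omega)$ denotes the class of finite simple graphs $G$ with maximum degree $\Delta(G)\le\Delta$ and clique number $\omega(G)\le\omega$. $k_t(G)$ is the number of copies of $K_t$ in $G$ and $\rho_t(G)=k_t(G)/|V(G)|$. $f_t(\Delta,\omega)=\sup\{\rho_t(G): G\in\mathcal{G}(\Delta,\omega),\ |V(G)|\ge 1\}$. $T(n,r)$ denotes the $r$-partite Turán graph on $n$ vertices; for $r\ge 4$, $T(r+2,r)$ has $r-2$ parts of size $1$ and two parts of size $2$. *)

(* Defs.v *)
From HB Require Import structures.
From mathcomp Require Import all_boot all_order all_algebra.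
Set Implicit Arguments. Unset Strict Implicit. Unset Printing Implicit Defensive.
Import Order.TTheory GRing.Theory Num.Theory.

Definition simple_graph (T : finType) (e : rel T) : Prop :=
  symmetric e /\ irreflexive e.

Definition is_clique (T : finType) (e : rel T) (S : {set T}) : bool :=
  [forall x in S, forall y in S, (x != y) ==> e x y].

Definition kt (T : finType) (e : rel T) (t : nat) : nat :=
  #|[set S : {set T} | (#|S| == t) && is_clique e S]|.

Definition max_deg_le (T : finType) (e : rel T) (D : nat) : Prop :=
  forall x : T, #|[set y | e x y]| <= D.

Definition clique_num_le (T : finType) (e : rel T) (w : nat) : Prop :=
  forall S : {set T}, is_clique e S -> #|S| <= w.

Definition in_class (T : finType) (e : rel T) (D w : nat) : Prop :=
  max_deg_le e D /\ clique_num_le e w.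

Definition rho (T : finType) (e : rel T) (t : nat) : rat :=
  ((kt e t)%:R / (#|T|)%:R)%R.

(* Turán graph T(n, r): vertices 0..n-1, part of i is i mod r (balanced
   r-partition), edges between distinct parts. *)
Definition turan (n r : nat) : rel 'I_n :=
  fun i j => (i %% r) != (j %% r).
Arguments turan : clear implicits.

(* Main.v *)
Require Import Defs.
From HB Require Import structures.
From mathcomp Require Import all_boot all_order all_algebra.
From mathcomp Require Import zify.
Import Order.TTheory GRing.Theory Num.Theory.

(** Let [c v] be the number of [(r-1)]-cliques through [v], so that the [c v]
    sum to [(r-1) k_(r-1)]; the bound amounts to [c] having average at most
    [M = 4(r-1)^2/(r+2)].  Vertices of degree at most [r] satisfy
    [c v <= 2r-2 <= M].  If [v] has degree [r+1], an [(r-1)]-clique through [v]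
    is the complement, in the closed neighbourhood [S] of [v], of a triple of
    neighbours covering all non-edges inside [S]; since [omega <= r], no single
    vertex covers them.  If the graph of non-edges contains [P3 + K2], [3K2], a
    paw or [C4], at most [2r-1] triples cover it, and [2r-1 <= M].  Otherwise it
    is a triangle, [2K2] or [P4]; then most vertices of [S] are twins of [v],
    every [(r-1)]-clique meeting [S] lies in [S], and [S] carries at most [4r-4]
    of them, so the [r+2] vertices of [S] can be deleted by induction. *)

(** * Counting the triples that cover a small graph *)

Section TripleCovers.
Variable T : finType.
Implicit Types (N X B : {set T}) (F : {set {set T}}).

(** Removing [B] is injective on supersets of [B] and lands in the subsets of [N :\: B]. *)
Lemma card_supersets_in B N n :
  #|[set X : {set T} | [&& B \subset X, X \subset N & #|X| == n]]|
    <= 'C(#|N :\: B|, n - #|B|).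
Proof.
set F := [set X | _].
have inj : {in F &, injective (fun X => X :\: B)}.
  move=> X Y; rewrite !inE => /and3P[sX _ _] /and3P[sY _ _] e.
  by rewrite -(setID X B) -(setID Y B) e (setIidPr sX) (setIidPr sY).
rewrite -(card_in_imset inj) -cards_draws; apply/subset_leq_card/subsetP.
move=> _ /imsetP[X + ->]; rewrite !inE => /and3P[sX sN /eqP cX].
by rewrite setSD //= cardsD (setIidPr sX) cX.
Qed.

Lemma card_sub_setU (U : finType) (F A B : {set U}) m n p :
  F \subset A :|: B -> #|A| <= m -> #|B| <= n -> m + n <= p -> #|F| <= p.
Proof.
move=> /subset_leq_card s Am Bn; apply: leq_trans; apply: leq_trans s _.
by apply: leq_trans (leq_card_setU _ _) (leq_add Am Bn).
Qed.

Definition pair_sets N k a b :=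
  [set X : {set T} | [&& [set a; b] \subset X, X \subset N & #|X| == k]].

Lemma card_pair_sets N a b : a \in N -> b \in N -> a != b ->
  #|pair_sets N 3 a b| <= #|N| - 2.
Proof.
move=> aN bN ab; apply: leq_trans (card_supersets_in _ _ _) _.
have s : [set a; b] \subset N by rewrite subUset !sub1set aN.
by rewrite cardsD (setIidPr s) cards2 ab bin1.
Qed.

(** Inclusion-exclusion over the triples missing [{a, b}] or [{c, d}]: C(n,3) - 2 C(n-2,3) +
    C(n-4,3) = 4n - 12. The exact value serves both the upper bound and the Turán count. *)
Lemma card_triples_meeting N a b c d : uniq [:: a; b; c; d] ->
  {subset [:: a; b; c; d] <= N} ->
  #|[set X : {set T} | [&& X \subset N, #|X| == 3, (a \in X) || (b \in X)
                         & (c \in X) || (d \in X)]]| = 4 * #|N| - 12.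
Proof.
move=> U sub.
pose D (A : {set T}) := [set X : {set T} | X \subset A & #|X| == 3].
have cD (A : {set T}) : #|D A| = 'C(#|A|, 3) by rewrite -cards_draws.
set A := N :\: [set a; b]; set B := N :\: [set c; d].
have -> : [set X : {set T} | [&& X \subset N, #|X| == 3, (a \in X) || (b \in X)
                         & (c \in X) || (d \in X)]] = D N :\: (D A :|: D B).
  apply/setP=> X; rewrite !inE !subsetD.
  have dis x y : [disjoint X & [set x; y]] = ~~ ((x \in X) || (y \in X)).
    by rewrite disjoint_sym disjoints_subset subUset !sub1set !inE -negb_or.
  rewrite !dis; case: (X \subset N) => //=; case: (#|X| == 3) => //=; last by rewrite !andbF.
  by rewrite !andbT negb_or !negbK.
have sA : D A :|: D B \subset D N.
  apply/subsetP=> X; rewrite !inE => /orP[]/andP[s ->]; rewrite andbT;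
  by apply: subset_trans s (subsetDl _ _).
have eI : D A :&: D B = D (A :&: B).
  by apply/setP=> X; rewrite !inE subsetI; case: (#|X| == 3); rewrite ?andbT ?andbF.
have := cardsUI (D A) (D B); rewrite eI !cD.
rewrite cardsD (setIidPr sA) cD.
have [aN bN cN dN] : [/\ a \in N, b \in N, c \in N & d \in N].
  by split; apply: sub; rewrite !inE eqxx ?orbT.
move: U; rewrite /= !inE !negb_or => /and4P[/and3P[ab ac ad] /andP[bc bd] cd _].
have cA : #|A| = #|N| - 2.
  by rewrite cardsD (setIidPr _) ?cards2 ?ab // subUset !sub1set aN.
have cB : #|B| = #|N| - 2.
  by rewrite cardsD (setIidPr _) ?cards2 ?cd // subUset !sub1set cN.
have cAB : #|A :&: B| = #|N| - 4.
  have -> : A :&: B = N :\: [set a; b; c; d].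
    by apply/setP=> x; rewrite !inE; case: (x \in N); rewrite ?andbF //=
       -!orbA !negb_or ?andbT -!andbA.
  rewrite cardsD (setIidPr _); last by rewrite !subUset !sub1set aN bN cN.
  by rewrite -!setUA !cardsU1 cards1 !inE !negb_or ab ac ad bc bd cd.
have N4 : 4 <= #|N|.
  apply: leq_trans (subset_leq_card (_ : [set a; b; c; d] \subset N)).
    by rewrite -!setUA !cardsU1 cards1 !inE !negb_or ab ac ad bc bd cd.
  by rewrite !subUset !sub1set aN bN cN.
rewrite cA cB cAB; case: #|N| N4 => [|[|[|[|m]]]] // _.
have [-> ->] : m.+4 - 2 = m.+2 /\ m.+4 - 4 = m by clear; lia.
rewrite !binS !bin0 !bin1; clear; lia.
Qed.

Variables (N : {set T}) (F : {set {set T}}).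
Hypothesis FN : forall X, X \in F -> X \subset N /\ #|X| = 3.

(** Members of [F] act as vertex covers, the pair [x], [y] as an edge to be covered. *)
Definition hit (x y : T) := forall X, X \in F -> (x \in X) || (y \in X).

Lemma pair_setsF X a b : X \in F -> a \in X -> b \in X -> X \in pair_sets N 3 a b.
Proof.
by move=> /FN[sX cX] aX bX; rewrite inE subUset !sub1set aX bX sX cX.
Qed.

Lemma triple_eq X a b c : X \in F -> a != b -> a != c -> b != c ->
  a \in X -> b \in X -> c \in X -> X = [set a; b; c].
Proof.
move=> /FN[sX cX] ab ac bc aX bX cXX.
apply/eqP; rewrite eq_sym eqEcard !subUset !sub1set aX bX cXX cX.
by rewrite -setUA !cardsU1 cards1 !inE negb_or ab ac bc.
Qed.

(** A cover of a 4-cycle contains one of its two diagonals. *)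
Lemma card_C4_covers a b c d : {subset [:: a; b; c; d] <= N} -> uniq [:: a; b; c; d] ->
  hit a b -> hit b c -> hit c d -> hit d a -> #|F| <= 2 * #|N| - 3.
Proof.
move=> sub U hab hbc hcd hda.
have [aN bN cN dN] : [/\ a \in N, b \in N, c \in N & d \in N].
  by split; apply: sub; rewrite !inE eqxx ?orbT.
move: U; rewrite /= !inE !negb_or => /and4P[/and3P[ab ac ad] /andP[bc bd] cd _].
have s : F \subset pair_sets N 3 a c :|: pair_sets N 3 b d.
  apply/subsetP=> X FX; rewrite inE.
  move: (hab X FX) (hbc X FX) (hcd X FX) (hda X FX).
  case aX: (a \in X); case cX: (c \in X); first by rewrite (pair_setsF X a c FX aX cX).
  - by rewrite orbF /= => _ bX dX _; rewrite (pair_setsF X b d FX bX dX) orbT.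
  - by rewrite orbF /= => bX _ _ dX; rewrite (pair_setsF X b d FX bX dX) orbT.
  - by rewrite orbF /= => bX _ dX _; rewrite (pair_setsF X b d FX bX dX) orbT.
apply: (card_sub_setU _ _ _ _ _ _ _ s (card_pair_sets N a c aN cN ac)
                     (card_pair_sets N b d bN dN bd)); clear; lia.
Qed.

(* The triples through the hub [c] and [a] or [b], plus [{a, b, d}]. *)
Lemma card_paw_covers a b c d : {subset [:: a; b; c; d] <= N} -> uniq [:: a; b; c; d] ->
  hit a b -> hit b c -> hit c a -> hit c d -> #|F| <= 2 * #|N| - 3.
Proof.
move=> sub U hab hbc hca hcd.
have [aN bN cN dN] : [/\ a \in N, b \in N, c \in N & d \in N].
  by split; apply: sub; rewrite !inE eqxx ?orbT.
move: U; rewrite /= !inE !negb_or => /and4P[/and3P[ab ac ad] /andP[bc bd] cd _].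
have s : F \subset pair_sets N 3 a c :|: pair_sets N 3 b c :|: [set [set a; b; d]].
  apply/subsetP=> X FX; rewrite inE.
  move: (hab X FX) (hbc X FX) (hca X FX) (hcd X FX).
  case cX: (c \in X) => /=.
    by case/orP=> aX _ _ _; rewrite inE ?(pair_setsF X a c FX aX cX)
      ?(pair_setsF X b c FX aX cX) ?orbT.
  move=> _; rewrite orbF => bX aX dX.
  by rewrite (triple_eq _ _ _ _ FX ab ad bd aX bX dX) ?inE ?eqxx ?orbT.
have s' := card_sub_setU _ _ _ _ _ _ _ (subxx _) (card_pair_sets N a c aN cN ac)
                     (card_pair_sets N b c bN cN bc) (leqnn _).
apply: (card_sub_setU _ _ _ _ _ _ _ s s' (_ : _ <= 1)); first by rewrite cards1.
have : #|[set a; b; c]| <= #|N| by apply: subset_leq_card; rewrite !subUset !sub1set aN bN.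
rewrite -setUA !cardsU1 cards1 !inE negb_or ab ac bc; clear; lia.
Qed.

(** A cover contains the middle [d] of the path with [a] or [b]; otherwise it contains [c] and [f],
    and [a] or [b] completes the triple. *)
Lemma card_P3_K2_covers a b c d f : {subset [:: a; b; c; d; f] <= N} ->
  uniq [:: a; b; c; d; f] ->
  hit a b -> hit c d -> hit d f -> #|F| <= 2 * #|N| - 3.
Proof.
move=> sub U hab hcd hdf.
have [aN bN cN dN fN] : [/\ a \in N, b \in N, c \in N, d \in N & f \in N].
  by split; apply: sub; rewrite !inE eqxx ?orbT.
move: U; rewrite /= !inE !negb_or.
move=> /and5P[/and4P[ab ac ad af] /and3P[bc bd bf] /andP[cd cf] df _].
have s : F \subset pair_sets N 3 a d :|: pair_sets N 3 b d
                   :|: [set [set a; c; f]; [set b; c; f]].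
  apply/subsetP=> X FX; rewrite inE.
  move: (hab X FX) (hcd X FX) (hdf X FX).
  case dX: (d \in X) => /=.
    by case/orP=> aX _ _; rewrite inE ?(pair_setsF X a d FX aX dX)
      ?(pair_setsF X b d FX aX dX) ?orbT.
  rewrite orbF => + cX fX; case/orP=> aX.
    by rewrite (triple_eq _ _ _ _ FX ac af cf aX cX fX) ?inE ?eqxx ?orbT.
  by rewrite (triple_eq _ _ _ _ FX bc bf cf aX cX fX) ?inE ?eqxx ?orbT.
have c2 : #|[set [set a; c; f]; [set b; c; f]]| <= 2 by rewrite cards2; case: (_ == _).
(* The triple [{a, b, d}] lies in both families, which saves one over 2(n-2) and makes room for the
   two extra triples. *)
suff s' : #|pair_sets N 3 a d :|: pair_sets N 3 b d| <= 2 * #|N| - 5.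
  apply: (card_sub_setU _ _ _ _ _ _ _ s s' c2).
  have : #|[set a; b; c]| <= #|N| by apply: subset_leq_card; rewrite !subUset !sub1set aN bN.
  rewrite -setUA !cardsU1 cards1 !inE negb_or ab ac bc; clear; lia.
have : 0 < #|pair_sets N 3 a d :&: pair_sets N 3 b d|.
  apply/card_gt0P; exists [set a; b; d]; rewrite !inE !subUset !sub1set !inE !eqxx !orbT aN bN dN.
  by rewrite -setUA !cardsU1 cards1 !inE negb_or ab ad bd.
have := cardsUI (pair_sets N 3 a d) (pair_sets N 3 b d).
have := card_pair_sets N a d aN dN ad; have := card_pair_sets N b d bN dN bd; clear; lia.
Qed.

(** A triple covering three disjoint edges takes one end of each, so there are at most 8; six
    vertices give 2n - 3 >= 9. *)
Lemma card_3K2_covers a b c d f g : {subset [:: a; b; c; d; f; g] <= N} ->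
  uniq [:: a; b; c; d; f; g] ->
  hit a b -> hit c d -> hit f g -> #|F| <= 2 * #|N| - 3.
Proof.
move=> sub U hab hcd hfg.
have N6 : 6 <= #|N|.
  rewrite -[6]/(size [:: a; b; c; d; f; g]) -(card_uniqP U).
  by apply/subset_leq_card/subsetP.
pose t (p : T * T * T) := [set p.1.1; p.1.2; p.2].
have s : F \subset [set t p | p in setX (setX [set a; b] [set c; d]) [set f; g]].
  apply/subsetP=> X FX.
  have [x xab xX] : exists2 x, x \in [set a; b] & x \in X.
    by case/orP: (hab X FX) => ?; [exists a|exists b]; rewrite // !inE eqxx ?orbT.
  have [y ycd yX] : exists2 x, x \in [set c; d] & x \in X.
    by case/orP: (hcd X FX) => ?; [exists c|exists d]; rewrite // !inE eqxx ?orbT.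
  have [z zfg zX] : exists2 x, x \in [set f; g] & x \in X.
    by case/orP: (hfg X FX) => ?; [exists f|exists g]; rewrite // !inE eqxx ?orbT.
  apply/imsetP; exists (x, y, z); first by rewrite !in_setX xab ycd zfg.
  move: xX yX zX; suff /and3P[xy xz yz] : [&& x != y, x != z & y != z].
    exact: (triple_eq _ _ _ _ FX).
  move: U xab ycd zfg; rewrite /= !inE !negb_or => U.
  move: U => /and5P[/and5P[_ ac ad af ag] /and4P[bc bd bf bg] /and3P[_ cf cg] /andP[df dg] _].
  by do 3!(case/orP=> /eqP->); apply/and3P; split.
apply: leq_trans (subset_leq_card s) (leq_trans (leq_imset_card _ _) _).
by rewrite !cardsX !cards2; do 3!case: (_ != _); move: N6; clear; lia.
Qed.

Lemma card_2K2_covers a b c d : {subset [:: a; b; c; d] <= N} -> uniq [:: a; b; c; d] ->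
  hit a b -> hit c d -> #|F| <= 4 * #|N| - 12.
Proof.
move=> sub U hab hcd; rewrite -(card_triples_meeting _ _ _ _ _ U sub).
apply/subset_leq_card/subsetP=> X FX; rewrite inE hab // hcd //.
by have [-> ->] := FN X FX.
Qed.

(** A cover of a triangle contains two of its vertices. *)
Lemma card_K3_covers a b c : {subset [:: a; b; c] <= N} -> uniq [:: a; b; c] ->
  hit a b -> hit b c -> hit c a -> #|F| <= 3 * (#|N| - 2).
Proof.
move=> sub U hab hbc hca.
have [aN bN cN] : [/\ a \in N, b \in N & c \in N].
  by split; apply: sub; rewrite !inE eqxx ?orbT.
move: U; rewrite /= !inE !negb_or => /and3P[/andP[ab ac] bc _].
have s : F \subset pair_sets N 3 a c :|: pair_sets N 3 b c :|: pair_sets N 3 a b.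
  apply/subsetP=> X FX; rewrite !in_setU.
  move: (hab X FX) (hbc X FX) (hca X FX).
  case aX: (a \in X); case cX: (c \in X); case bX: (b \in X) => // _ _ _;
  by rewrite ?(pair_setsF X a b FX aX bX) ?(pair_setsF X a c FX aX cX)
    ?(pair_setsF X b c FX bX cX) ?orbT.
have s' := card_sub_setU _ _ _ _ _ _ _ (subxx _) (card_pair_sets N a c aN cN ac)
                     (card_pair_sets N b c bN cN bc) (leqnn _).
apply: (card_sub_setU _ _ _ _ _ _ _ s s' (card_pair_sets N a b aN bN ab)); clear; lia.
Qed.

End TripleCovers.

(** * Which graphs have many covering triples *)

Ltac subgraph_side := solve
  [ assumption
  | by rewrite /= ?inE ?negb_or; repeat (apply/andP; split);
       first [assumption | done | by rewrite eq_sym]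
  | by apply/allP => /=; repeat (apply/andP; split)
  | match goal with
    | H : forall x y, is_true (_ x y) -> hit _ _ _ _,
      S : forall x y, is_true (_ x y) -> is_true (_ y x) |- _ =>
        by apply: H; first [assumption | apply: S; assumption]
    end ].

(** The last two outcomes are the triangle, and 2K2 or P4. If no two edges are disjoint, the absence
    of a covering vertex leaves only the triangle; otherwise two disjoint edges are extended by
    whatever other edges exist. *)
Lemma triple_cover_dichotomy (T : finType) (h : rel T) (N : {set T})
    (F : {set {set T}}) (z0 : T) :
  symmetric h -> irreflexive h ->
  (forall x y, h x y -> x \in N) ->
  (forall X, X \in F -> X \subset N /\ #|X| = 3) ->
  (forall x y, h x y -> hit T F x y) ->
  (forall z, exists x y, [/\ x != z, y != z & h x y]) ->
  [\/ #|F| <= 2 * #|N| - 3,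
    exists a b c, [/\ uniq [:: a; b; c], h a b, h b c, h c a
      & forall x y, h x y -> x \in [:: a; b; c]]
  | exists a b c d, [/\ uniq [:: a; b; c; d], h a b, h c d,
      forall x y, h x y -> x \in [:: a; b; c; d]
      & h a c + h a d + h b c + h b d <= 1]].
Proof.
move=> sym irr hN FN hF nocover.
have hneq x y : h x y -> x != y by move=> hxy; apply: contraTneq hxy => ->; rewrite irr.
have hN' x y : h x y -> y \in N by rewrite sym; apply: hN.
case: (boolP [exists a, exists b, exists c, exists d,
                [&& h a b, h c d & uniq [:: a; b; c; d]]]).
  case/existsP=> a /existsP[b /existsP[c /existsP[d /and3P[hab hcd U]]]].
  have := U; rewrite /= !inE !negb_or => /and4P[/and3P[ab ac ad] /andP[bc bd] cd _].
  have [aN bN cN dN] := And4 (hN _ _ hab) (hN' _ _ hab) (hN _ _ hcd) (hN' _ _ hcd).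
  have hba : h b a by rewrite sym.
  have hdc : h d c by rewrite sym.
  case: (boolP [forall x, forall y, h x y ==> (x \in [:: a; b; c; d])]) => [/forallP win|].
    case: (leqP (h a c + h a d + h b c + h b d) 1) => [le1|two].
      apply: Or33; exists a, b, c, d; split=> // x y.
      by move/forallP: (win x) => /(_ y)/implyP.
    apply: Or31.
    have C4 := card_C4_covers T N F FN; have paw := card_paw_covers T N F FN.
    have symh x y : h x y -> h y x by rewrite sym.
    (* Two disjoint cross edges close a 4-cycle; two that share an end form a triangle with a
       pendant edge, a paw. *)
    case hac: (h a c) two; case hbd: (h b d) => two.
    - by apply: (C4 a b d c); subgraph_side.
    - case had: (h a d) two; case hbc: (h b c) => two //.
      - by apply: (C4 a b c d); subgraph_side.
      - by apply: (paw c d a b); subgraph_side.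
      - by apply: (paw a b c d); subgraph_side.
    - case had: (h a d) two; case hbc: (h b c) => two //.
      - by apply: (C4 a b c d); subgraph_side.
      - by apply: (paw a b d c); subgraph_side.
      - by apply: (paw c d b a); subgraph_side.
    - case had: (h a d) two; case hbc: (h b c) => two //.
      by apply: (C4 a b c d); subgraph_side.
  rewrite negb_forall => /existsP[x]; rewrite negb_forall => /existsP[y].
  rewrite negb_imply => /andP[hxy xn]; apply: Or31.
  have symh u v : h u v -> h v u by rewrite sym.
  have P3 := card_P3_K2_covers T N F FN.
  have xN := hN _ _ hxy; have yN := hN' _ _ hxy.
  move: xn; rewrite !inE !negb_or => /and4P[xa xb xc xd].
  have xy := hneq _ _ hxy.
  (* The edge [xy] leaves the four vertices: it either extends [ab] or [cd] to a path or is a third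
     disjoint edge. *)
  have [ya|ya] := eqVneq y a; first by subst y; apply: (P3 c d x a b); subgraph_side.
  have [yb|yb] := eqVneq y b; first by subst y; apply: (P3 c d x b a); subgraph_side.
  have [yc|yc] := eqVneq y c; first by subst y; apply: (P3 a b x c d); subgraph_side.
  have [yd|yd] := eqVneq y d; first by subst y; apply: (P3 a b x d c); subgraph_side.
  by apply: (card_3K2_covers T N F FN a b c d x y); subgraph_side.
move=> nodisj.
have disj a b c d : h a b -> h c d ->
    [|| c == a, c == b, d == a | d == b].
  move=> hab hcd; apply: contraR nodisj; rewrite !negb_or => /and4P[ca cb da db].
  apply/existsP; exists a; apply/existsP; exists b; apply/existsP; exists c.
  apply/existsP; exists d; rewrite hab hcd /= !inE !negb_or (hneq _ _ hab) (hneq _ _ hcd).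
  by rewrite !(eq_sym a) !(eq_sym b) ca cb da db.
(* Edges now meet pairwise: an edge avoiding [a] meets [ab] in [b], which gives [c], and an edge
   avoiding [b] must then be [ac]. *)
have [a [b [_ _ hab]]] := nocover z0.
have [c [ca cb hbc]] : exists c, [/\ c != a, c != b & h b c].
  have [x [y [xa ya hxy]]] := nocover a.
  move: (disj _ _ _ _ hab hxy); rewrite (negPf xa) (negPf ya) /= => /orP[]/eqP e; subst.
    by exists y; rewrite ya eq_sym (hneq _ _ hxy).
  by exists x; rewrite xa (hneq _ _ hxy) sym.
have hca : h c a.
  have [x [y [xb yb hxy]]] := nocover b.
  move: (disj _ _ _ _ hab hxy) (disj _ _ _ _ hbc hxy).
  rewrite (negPf xb) (negPf yb) /= !orbF.
  case/orP=> /eqP e; rewrite e in hxy *; rewrite (eq_sym a) (negPf ca) ?orbF => /eqP <- //.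
  by rewrite sym.
apply: Or32; exists a, b, c; split=> //.
  by rewrite /= !inE !negb_or (hneq _ _ hab) (eq_sym a) ca (hneq _ _ hbc).
move=> x y hxy; rewrite !inE; apply: contraT; rewrite !negb_or => /and3P[xa xb xc].
move: (disj _ _ _ _ hab hxy) (disj _ _ _ _ hbc hxy) (disj _ _ _ _ hca hxy).
rewrite (negPf xa) (negPf xb) (negPf xc) /=.
have [/negPf ab /negPf bc] := conj (hneq _ _ hab) (hneq _ _ hbc).
by case/orP=> /eqP->; rewrite ?(eq_sym b a) ?(eq_sym a c) ab ?bc ?(negPf ca).
Qed.

(** * Cliques through a vertex and their complements *)

Section Cliques.
Variables (T : finType) (e : rel T).
Hypotheses (sym : symmetric e) (irr : irreflexive e).

Lemma cliqueP (Q : {set T}) :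
  reflect {in Q &, forall x y, x != y -> e x y} (is_clique e Q).
Proof.
apply: (iffP forall_inP) => [H x y xQ yQ|H x xQ].
  by have /forall_inP/(_ y yQ)/implyP := H x xQ.
by apply/forall_inP=> y yQ; apply/implyP; apply: H.
Qed.

Lemma not_cliqueP (Q : {set T}) : ~~ is_clique e Q ->
  exists x y, [/\ x \in Q, y \in Q, x != y & ~~ e x y].
Proof.
rewrite negb_forall_in => /exists_inP[x xQ]; rewrite negb_forall_in.
by case/exists_inP=> y yQ; rewrite negb_imply => /andP[xy exy]; exists x, y.
Qed.

Definition cliques t := [set Q : {set T} | (#|Q| == t) && is_clique e Q].
Definition cliques_at t v := [set Q in cliques t | v \in Q].
Definition nbhd v := [set y | e v y].
Definition nonisolated := [set x | [exists y, e x y]].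

(** Double counting of incidences between vertices and cliques. *)
Lemma sum_cliques_at t : \sum_v #|cliques_at t v| = t * kt e t.
Proof.
under eq_bigr => v _ do rewrite -sum1dep_card big_mkcondr.
rewrite exchange_big /= mulnC -sum_nat_const; apply: eq_bigr => Q.
by rewrite inE => /andP[/eqP <- _]; rewrite -big_mkcond sum1_card.
Qed.

Lemma card_compl_family (S : {set T}) (F : {set {set T}}) :
  (forall Q, Q \in F -> Q \subset S) -> #|[set S :\: Q | Q : {set T} in F]| = #|F|.
Proof.
move=> sub; rewrite card_in_imset // => P Q /sub sP /sub sQ eq.
by rewrite -(setIidPr sP) -(setIidPr sQ) -[S :&: P]set0U -[S :&: Q]set0U -(setDv S) -!setDDr eq.
Qed.

(** A clique cannot contain both ends of a non-edge. This turns counting cliques into counting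
    covers. *)
Lemma hit_compl_cliques (S : {set T}) (F : {set {set T}}) x y :
  (forall Q, Q \in F -> is_clique e Q) -> x \in S -> y \in S ->
  x != y -> ~~ e x y -> hit T [set S :\: Q | Q : {set T} in F] x y.
Proof.
move=> cl xS yS xy nexy _ /imsetP[Q /cl/cliqueP clQ ->]; rewrite !inE xS yS !andbT.
by apply: contraR nexy; rewrite negb_or !negbK => /andP[xQ yQ]; apply: clQ.
Qed.

Lemma clique_at_sub t v Q : Q \in cliques_at t v -> Q \subset v |: nbhd v.
Proof.
rewrite !inE => /andP[/andP[_ /cliqueP cl] vQ]; apply/subsetP=> x xQ.
by rewrite !inE; case: eqVneq => //= xv; apply: cl => //; rewrite eq_sym.
Qed.

Lemma card_closed_nbhd v : #|v |: nbhd v| = #|nbhd v|.+1.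
Proof. by rewrite cardsU1 !inE irr. Qed.

Lemma compl_clique_at t v Q : Q \in cliques_at t v ->
  (v |: nbhd v) :\: Q \subset nbhd v /\ #|(v |: nbhd v) :\: Q| = #|nbhd v|.+1 - t.
Proof.
move=> QF; have sub := clique_at_sub _ _ _ QF.
move: QF; rewrite !inE => /andP[/andP[/eqP cQ _] vQ]; split.
  by apply/subsetP=> x; rewrite !inE => /andP[xQ /orP[/eqP xv|//]]; rewrite xv vQ in xQ.
by rewrite cardsD (setIidPr sub) cQ card_closed_nbhd.
Qed.

Variable r : nat.
Hypotheses (r5 : 5 <= r) (cls : in_class e r.+1 r).

Lemma large_not_clique (Q : {set T}) : r < #|Q| -> ~~ is_clique e Q.
Proof. by move=> Qr; apply/negP => /(cls.2 Q); rewrite leqNgt Qr. Qed.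

(** At degree [r] the closed neighbourhood has r+1 vertices, hence a non-edge [ab]; complements of
    cliques are pairs of neighbours containing [a] or [b], at most r-1 for each. At smaller degree
    one chooses r-2 of at most r-1 neighbours. *)
Lemma card_cliques_at_low_degree v : #|nbhd v| <= r ->
  #|cliques_at r.-1 v| <= 2 * r - 2.
Proof.
rewrite leq_eqVlt => /orP[/eqP dv|dv].
  have [|a [b [aS bS ab nab]]] := not_cliqueP (v |: nbhd v) _.
    by apply: large_not_clique; rewrite card_closed_nbhd dv.
  have nv x y : x \in v |: nbhd v -> y \in v |: nbhd v -> x != y -> ~~ e x y -> x \in nbhd v.
    rewrite !inE => /orP[/eqP-> /orP[/eqP->|->//]|//]; by rewrite eqxx.
  have aN := nv _ _ aS bS ab nab.
  have bN : b \in nbhd v by apply: (nv b a); rewrite // 1?eq_sym // sym.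
  rewrite -(card_compl_family (v |: nbhd v)); last by move=> Q; apply: clique_at_sub.
  set F := [set _ | _ in _].
  pose G x := [set X : {set T} | [&& [set x] \subset X, X \subset nbhd v & #|X| == 2]].
  have cG x : x \in nbhd v -> #|G x| <= r.-1.
    move=> xN; apply: leq_trans (card_supersets_in _ _ _ _) _.
    by rewrite cards1 subSS subn0 bin1 cardsD (setIidPr _) ?sub1set // cards1 dv subn1.
  apply: (card_sub_setU _ _ _ _ _ _ _ _ (cG a aN) (cG b bN)); last by clear -r5; lia.
  apply/subsetP=> X XF; rewrite !inE !sub1set.
  have hX : (a \in X) || (b \in X).
    apply: (hit_compl_cliques _ _ _ _ _ aS bS ab nab) XF => Q.
    by rewrite !inE => /andP[/andP[]].
  case/imsetP: XF hX => Q QF ->; have [-> ->] := compl_clique_at _ _ _ QF.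
  have -> : #|nbhd v|.+1 - r.-1 == 2 by rewrite dv; clear -r5; lia.
  by rewrite !andbT.
have s : cliques_at r.-1 v \subset
    [set Q : {set T} | [&& [set v] \subset Q, Q \subset v |: nbhd v & #|Q| == r.-1]].
  apply/subsetP=> Q QF; rewrite inE (clique_at_sub _ _ _ QF) sub1set.
  by move: QF; rewrite !inE => /andP[/andP[-> _] ->].
apply: leq_trans (subset_leq_card s) (leq_trans (card_supersets_in _ _ _ _) _).
rewrite cards1 cardsD (setIidPr _) ?sub1set ?inE ?eqxx // cards1 card_closed_nbhd subn1.
apply: leq_trans (leq_bin2l _ (_ : _ <= r.-1)) _; first by move: dv r5; clear; case: r.
case: r r5 => [//|[//|q]] _ /=; rewrite subn1 /= binSn; clear; lia.
Qed.

(* Vertices of [S] outside [A] are twins with closed neighbourhood [S], so a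
   clique leaving [S] avoids them and is confined to few neighbours of [w]. *)
Lemma leaving_clique (S A Q : {set T}) w x :
  #|S| = r.+2 -> A \subset S -> {in S :\: A, forall u y, y \in S -> y != u -> e u y} ->
  Q \in cliques r.-1 -> w \in Q -> w \in S -> x \in Q -> x \notin S ->
  [/\ w \in A, 2 * r <= r.+1 + #|A|
    & #|A| = 4 -> {in A, forall y, e w y -> y \in Q}].
Proof.
move=> cS sAS twin; rewrite inE => /andP[/eqP cQ /cliqueP clQ] wQ wS xQ xS.
(* A twin already has r+1 neighbours in [S], so the degree bound allows none outside. *)
have nbu u : u \in S :\: A -> nbhd u = S :\ u.
  move=> uK; apply/eqP; rewrite eq_sym eqEcard; apply/andP; split.
    by apply/subsetP=> y; rewrite !inE => /andP[yu yS]; apply: twin.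
  move: uK; rewrite inE => /andP[_ uS]; apply: leq_trans (cls.1 u : #|nbhd u| <= _) _.
  by have := cardsD1 u S; rewrite uS cS; clear; lia.
have KQ u : u \in S :\: A -> u \notin Q.
  move=> uK; apply: contra (xS) => uQ; have: x \in nbhd u.
    rewrite inE; apply: clQ => //; apply: contraNneq (xS) => <-.
    by move: uK; rewrite inE => /andP[].
  by rewrite nbu // !inE => /andP[].
have wA : w \in A by apply: contraLR wQ => wA; apply: KQ; rewrite inE wA.
(* These parts are disjoint, of sizes r+2-|A| and r-2, and together fit in at most r+1
   neighbours. *)
have sub : (S :\: A) :|: (Q :\ w) \subset nbhd w.
  apply/subsetP=> y; rewrite !inE => /orP[/andP[yA yS]|/andP[yw yQ]]; last first.
    by apply: clQ => //; rewrite eq_sym.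
  by rewrite sym; apply: twin; rewrite ?inE ?yA //; apply: contraNneq yA => <-.
have card : #|(S :\: A) :|: (Q :\ w)| = r.+2 - #|A| + r.-2.
  rewrite cardsU (_ : _ :&: _ = set0) ?cards0 ?subn0; last first.
    apply/setP=> y; rewrite !inE; apply/negP=> /andP[yK /andP[_]]; apply/negP.
    by apply: KQ; rewrite inE.
  rewrite cardsD (setIidPr sAS) cS; congr (_ + _).
  by have := cardsD1 w Q; rewrite wQ cQ; clear; case: r => [|[|q]] /=; lia.
have := subset_leq_card sub; rewrite card => le.
have dw : #|nbhd w| <= r.+1 := cls.1 w.
have AS : #|A| <= r.+2 by rewrite -cS; apply: subset_leq_card.
split=> //; first by move: le dw AS r5; clear; lia.
(* For |A| = 4 the union has 2r-4 >= r+1 elements, so it exhausts the neighbourhood of [w]; this can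
   occur only for r = 5. *)
move=> A4 y yA ewy.
have /setP/(_ y) : (S :\: A) :|: (Q :\ w) = nbhd w.
  apply/eqP; rewrite eqEcard sub card A4; move: dw r5; clear; lia.
by rewrite !inE yA ewy /= => /andP[].
Qed.

End Cliques.

(** * A vertex in many cliques yields a removable block *)

Section Dichotomy.
Variables (T : finType) (e : rel T).
Hypotheses (sym : symmetric e) (irr : irreflexive e).
Variable r : nat.
Hypotheses (r5 : 5 <= r) (cls : in_class e r.+1 r).

(** What deletion of [S] needs: the r+2 vertices lost pay for at most 4r-4 cliques lost, the ratio
    of the bound. *)
Definition closed_block (S : {set T}) :=
  [/\ #|S| = r.+2, S \subset nonisolated T e,
    {in cliques T e r.-1, forall Q : {set T}, ~~ [disjoint Q & S] -> Q \subset S}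
    & #|[set Q in cliques T e r.-1 | Q \subset S]| <= 4 * r - 4].

Lemma light_or_closed_block v :
  #|cliques_at T e r.-1 v| <= 2 * r - 1 \/ exists S, closed_block S.
Proof.
have [dv|dv] := leqP #|nbhd T e v| r.
  left; have := card_cliques_at_low_degree T e sym irr r r5 cls v dv.
  by move/leq_trans; apply; clear -r5; lia.
have {}dv : #|nbhd T e v| = r.+1 by apply/eqP; rewrite eqn_leq dv (cls.1 v).
set S := v |: nbhd T e v; set N := nbhd T e v in dv S *.
have NS x : x \in N -> x \in S by rewrite !inE => ->; rewrite orbT.
have cS : #|S| = r.+2 by rewrite /S card_closed_nbhd // -/N dv.
set F := [set S :\: Q | Q : {set T} in cliques_at T e r.-1 v].
have cF : #|F| = #|cliques_at T e r.-1 v|.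
  by apply: card_compl_family => Q; apply: clique_at_sub.
have FN X : X \in F -> X \subset N /\ #|X| = 3.
  case/imsetP=> Q QF ->; have [-> ->] := compl_clique_at T e irr _ _ _ QF.
  by rewrite -/N dv; split=> //; clear -r5; lia.
(* Since [v] is adjacent to all of [N], every non-edge inside [S] is an edge of [h]. *)
pose h x y := [&& x \in N, y \in N, x != y & ~~ e x y].
have hsym : symmetric h.
  by move=> x y; rewrite /h sym (eq_sym x); case: (x \in N); case: (y \in N).
have hirr : irreflexive h by move=> x; rewrite /h eqxx !andbF.
have hN x y : h x y -> x \in N by case/and4P.
have hF x y : h x y -> hit T F x y.
  case/and4P=> xN yN xy nxy; apply: (hit_compl_cliques T e); rewrite ?NS // => Q.
  by rewrite !inE => /andP[/andP[]].
have nN x y : x \in S -> y \in S -> x != y -> ~~ e x y -> x \in N.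
  rewrite !inE => /orP[/eqP-> /orP[/eqP->|->//]|//]; by rewrite eqxx.
have hI x y : x \in S -> y \in S -> x != y -> ~~ e x y -> h x y.
  move=> xS yS xy nxy; rewrite /h xy nxy (nN x y) // (nN y x) // 1?eq_sym //.
  by rewrite sym.
(* [S :\ z] has at least r+1 vertices, too many for a clique. *)
have nocover z : exists x y, [/\ x != z, y != z & h x y].
  have [|x [y [xS yS xy nxy]]] := not_cliqueP T e (S :\ z) _.
    apply: (large_not_clique T e r cls).
    by have := cardsD1 z S; rewrite cS; case: (z \in S); clear; lia.
  exists x, y; move: xS yS; rewrite !in_setD1 => /andP[-> xS] /andP[-> yS].
  by split=> //; apply: hI.
(* Cliques inside [S] may avoid [v], so their complements are triples in [S], not just in [N]. With
   |S| = r+2 the cover counts become 3r and 4r-4. *)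
pose F' := [set S :\: Q | Q : {set T} in [set Q in cliques T e r.-1 | Q \subset S]].
have cF' : #|F'| = #|[set Q in cliques T e r.-1 | Q \subset S]|.
  by apply: card_compl_family => Q; rewrite inE => /andP[].
have FN' X : X \in F' -> X \subset S /\ #|X| = 3.
  case/imsetP=> Q; rewrite !inE => /andP[/andP[/eqP cQ _] QS] ->.
  by rewrite subsetDl cardsD (setIidPr QS) cQ cS; split=> //; clear -r5; lia.
have hF' x y : h x y -> hit T F' x y.
  case/and4P=> xN yN xy nxy; apply: (hit_compl_cliques T e); rewrite ?NS // => Q.
  by rewrite !inE => /andP[/andP[]].
have Ssupp : S \subset nonisolated T e.
  have vv : v \in nonisolated T e.
    have /card_gt0P[y] : 0 < #|N| by rewrite dv.
    by rewrite !inE => evy; apply/existsP; exists y.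
  rewrite subUset sub1set vv; apply/subsetP=> y; rewrite !inE => evy.
  by apply/existsP; exists v; rewrite sym.
have twin (A : {set T}) : (forall x y, h x y -> x \in A) ->
    {in S :\: A, forall u y, y \in S -> y != u -> e u y}.
  move=> hA u; rewrite inE => /andP[uA uS] y yS yu; apply: contraR uA => nuy.
  by apply: (hA u y); apply: hI; rewrite // eq_sym.
case: (triple_cover_dichotomy T h N F v hsym hirr hN FN hF nocover).
- by rewrite cF dv => le; left; apply: leq_trans le _; clear; lia.
- case=> a [b [c [U hab hbc hca hA]]]; right; exists S.
  have sub : {subset [:: a; b; c] <= S}.
    by apply/allP; rewrite /= !NS ?(hN _ _ hab) ?(hN _ _ hbc) ?(hN _ _ hca).
  split=> //; last first.
    rewrite -cF'; apply: leq_trans (card_K3_covers T S F' FN' a b c sub U _ _ _) _;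
      by [apply: hF'|rewrite cS; clear -r5; lia].
  move=> Q QC; rewrite -setI_eq0 => /set0Pn[w]; rewrite inE => /andP[wQ wS].
  apply/subsetP=> x xQ; apply: contraT => xS.
  have AS : [set x in [:: a; b; c]] \subset S by apply/subsetP=> y; rewrite inE; apply: sub.
  have tw := twin [set x in [:: a; b; c]].
  (* With |A| = 3 this would give 2r <= r+4, against r >= 5. *)
  have [|_ + _] := leaving_clique T e sym r r5 cls S _ Q w x cS AS (tw _) QC wQ wS xQ xS.
    by move=> y z /hA; rewrite inE.
  by rewrite cardsE (card_uniqP U) /=; clear -r5; lia.
case=> a [b [c [d [U hab hcd hA le1]]]]; right; exists S.
have sub : {subset [:: a; b; c; d] <= S}.
  apply/allP; rewrite /= !NS ?(hN _ _ hab) ?(hN _ _ hcd) //.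
    by apply: (hN d c); rewrite hsym.
  by apply: (hN b a); rewrite hsym.
split=> //; last first.
  rewrite -cF'; apply: leq_trans (card_2K2_covers T S F' FN' a b c d sub U _ _) _;
    by [apply: hF'|rewrite cS; clear -r5; lia].
move=> Q QC; rewrite -setI_eq0 => /set0Pn[w0]; rewrite inE => /andP[wQ0 wS0].
apply/subsetP=> x xQ; apply: contraT => xS.
have AS : [set x in [:: a; b; c; d]] \subset S by apply/subsetP=> y; rewrite inE; apply: sub.
have tw : {in S :\: [set x in [:: a; b; c; d]], forall u y, y \in S -> y != u -> e u y}.
  by apply: twin => y z /hA; rewrite inE.
have cA : #|[set x in [:: a; b; c; d]]| = 4 by rewrite cardsE (card_uniqP U).
have leaving w wQ wS := leaving_clique T e sym r r5 cls S _ Q w x cS AS tw QC wQ wS xQ xS.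
have [wA _ _] := leaving w0 wQ0 wS0.
(* Vertices of [Q] among the four have no neighbours among the four outside [Q], so every pair split
   by [Q] is an edge of [h]. *)
have key p q : p \in [:: a; b; c; d] -> q \in [:: a; b; c; d] -> p != q ->
    (p \in Q) (+) (q \in Q) -> h p q.
  have one p' q' : p' \in [:: a; b; c; d] -> q' \in [:: a; b; c; d] -> p' != q' ->
      p' \in Q -> q' \notin Q -> h p' q'.
    move=> pA qA pq pQ qQ; have [_ _ /(_ cA) H] := leaving p' pQ (sub _ pA).
    apply: hI; rewrite ?sub //; apply: contra qQ; apply: H; by rewrite inE.
  move=> pA qA pq; case pQ: (p \in Q); case qQ: (q \in Q) => //= _.
    by apply: one; rewrite ?qQ.
  by rewrite hsym; apply: one; rewrite ?pQ // eq_sym.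
have nQ p q : h p q -> ~~ ((p \in Q) && (q \in Q)).
  case/and4P=> _ _ pq npq; apply: contra npq => /andP[pQ qQ].
  by move: QC; rewrite inE => /andP[_ /cliqueP]; apply.
have := U; rewrite /= !inE !negb_or => /and4P[/and3P[_ ac ad] /andP[bc bd] _ _].
have [A1 A2 A3 A4] : [/\ a \in [:: a; b; c; d], b \in [:: a; b; c; d],
    c \in [:: a; b; c; d] & d \in [:: a; b; c; d]] by rewrite !inE !eqxx !orbT.
(* [Q] contains one of the four vertices but not both ends of [ab] or of [cd]; hence it splits at
   least two cross pairs, against [le1]. *)
move: (key a c A1 A3 ac) (key a d A1 A4 ad) (key b c A2 A3 bc) (key b d A2 A4 bd).
move: (nQ a b hab) (nQ c d hcd) le1.
have : [|| a \in Q, b \in Q, c \in Q | d \in Q].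
  by move: wA wQ0; rewrite !inE => /or4P[]/eqP-> ->; rewrite ?orbT.
case: (a \in Q); case: (b \in Q); case: (c \in Q); case: (d \in Q) => //= _ _ _;
 case: (h a c); case: (h a d); case: (h b c); case: (h b d) => //= _ h1 h2 h3 h4;
 by [have := h1 isT|have := h2 isT|have := h3 isT|have := h4 isT].
Qed.

End Dichotomy.

(** * The upper bound by induction *)

(** Counting only non-isolated vertices lets the induction keep the vertex type fixed: a block is
    deleted by isolating its vertices. *)
Lemma cliques_upper_bound (T : finType) (r : nat) : 5 <= r ->
  forall (e : rel T), symmetric e -> irreflexive e -> in_class e r.+1 r ->
  (r + 2) * kt e r.-1 <= (4 * r - 4) * #|nonisolated T e|.
Proof.
move=> r5 e; have [n] := ubnP #|nonisolated T e|; elim: n e => // n IH e lt sym irr cls.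
pose light v := #|cliques_at T e r.-1 v| <= 2 * r - 1.
have [/forallP all_light|/forallPn[v nv]] := boolP [forall v, light v].
  have := sum_cliques_at T e r.-1.
  rewrite (bigID (mem (nonisolated T e))) /= [X in _ + X]big1 => [|v vs].
    rewrite addn0 => eqs.
    have : \sum_(i in nonisolated T e) #|cliques_at T e r.-1 i| <= #|nonisolated T e| * (2 * r - 1).
      by rewrite -sum_nat_const; apply: leq_sum => i _; apply: all_light.
    (* The averaging closes by (r+2)(2r-1) <= 4(r-1)^2, true from r = 5 on. *)
    rewrite eqs; move: #|nonisolated T e| (kt e r.-1) => s k; move: r5; clear.
    by case: r => //= q q4 H; nia.
  apply/eqP; rewrite cards_eq0; apply/eqP/setP=> Q; rewrite in_set0.
  apply: contraNF vs => QF; have := QF; rewrite !inE => /andP[/andP[/eqP cQ clQ] vQ].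
  have /card_gt0P[y] : 0 < #|Q :\ v|.
    by have := cardsD1 v Q; rewrite cQ vQ; move: r5; clear; lia.
  rewrite !inE => /andP[yv yQ]; apply/existsP; exists y.
  by apply: (cliqueP _ _ _ clQ); rewrite // eq_sym.
have [|[S [cS Ssupp closed cntS]]] := light_or_closed_block T e sym irr r r5 cls v.
  by move=> lv; rewrite /light lv in nv.
pose e' x y := [&& e x y, x \notin S & y \notin S].
have sym' : symmetric e'.
  by move=> x y; rewrite /e' sym; case: (x \in S); case: (y \in S); rewrite ?andbF.
have irr' : irreflexive e' by move=> x; rewrite /e' irr.
have sub' : nonisolated T e' \subset nonisolated T e :\: S.
  apply/subsetP=> x; rewrite !inE => /existsP[y /and3P[exy -> _]].
  by apply/existsP; exists y.
have card' : #|nonisolated T e'| + r.+2 <= #|nonisolated T e|.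
  have := subset_leq_card sub'; rewrite cardsD (setIidPr Ssupp) cS.
  have := subset_leq_card Ssupp; rewrite cS; clear; lia.
have cls' : in_class e' r.+1 r.
  split=> [x|Q clQ].
    apply: leq_trans (cls.1 x); apply/subset_leq_card/subsetP=> y.
    by rewrite !inE => /andP[].
  apply: cls.2; apply/cliqueP=> x y xQ yQ xy.
  by have /and3P[] := cliqueP _ _ _ clQ x y xQ yQ xy.
have := IH e' _ sym' irr' cls'; rewrite (leq_trans _ (_ : #|nonisolated T e| <= n)) //; last first.
  by move: card'; clear; lia.
move=> /(_ isT) IHe.
(* A clique disjoint from [S] survives in [e']; any other lies inside [S]. *)
have : kt e r.-1 <= kt e' r.-1 + (4 * r - 4).
  apply: (card_sub_setU _ _ (cliques T e' r.-1) _ _ _ _ _ (leqnn _) cntS (leqnn _)).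
  apply/subsetP=> Q QC; have QC' := QC; move: QC'; rewrite !inE => /andP[cQ clQ].
  rewrite cQ clQ /=; have [dis|/closed->//] := boolP [disjoint Q & S]; last by rewrite ?orbT.
  rewrite (introT (cliqueP _ _ _)) // => x y xQ yQ xy.
  by rewrite /e' (cliqueP _ _ _ clQ) // !(disjointFr dis).
move: IHe card' r5; clear; move: (kt _ _) (kt _ _) #|_| #|_| => k k' s' s; nia.
Qed.

Lemma rho_le (T : finType) (e : rel T) (r : nat) : 5 <= r ->
  simple_graph e -> in_class e r.+1 r -> 0 < #|T| ->
  (rho e r.-1 <= (4 * r - 4)%N%:R / (r + 2)%N%:R :> rat)%R.
Proof.
move=> r5 [sym irr] cls T0.
rewrite /rho ler_pdivrMr ?ltr0n // mulrAC ler_pdivlMr ?ltr0n ?addn2 //.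
rewrite -!natrM ler_nat -addn2 mulnC; apply: leq_trans (cliques_upper_bound _ _ r5 e sym irr cls) _.
by rewrite leq_mul2l max_card orbT.
Qed.

(** * The Turán graph attains the bound *)

Section Turan.
Variable r : nat.
Hypothesis r5 : 5 <= r.

Lemma turan_simple : simple_graph (turan (r + 2) r).
Proof. by split=> [i j|i]; rewrite /turan ?eqxx // eq_sym. Qed.

Lemma turan_in_class : in_class (turan (r + 2) r) r.+1 r.
Proof.
split=> [i|S /cliqueP clS].
  have -> : r.+1 = #|[set~ i]| by rewrite cardsC1 card_ord addn2.
  apply/subset_leq_card/subsetP=> j; rewrite !inE.
  by apply: contraTneq => ->; rewrite /turan eqxx.
have r0 : 0 < r by apply: leq_trans r5.
(* Residues modulo [r] are distinct on a clique. *)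
pose f (i : 'I_(r + 2)) := Ordinal (ltn_pmod i r0).
rewrite -[X in _ <= X]card_ord -(card_in_imset (f := f) (D := S)) ?max_card //.
move=> i j iS jS [eq]; apply/eqP; apply: contraT => /(clS i j iS jS).
by rewrite /turan eq eqxx.
Qed.

(** The complement of any triple meeting both two-element parts, [{0, r}] and [{1, r+1}], is an
    (r-1)-clique. *)
Lemma kt_turan_ge : 4 * r - 4 <= kt (turan (r + 2) r) r.-1.
Proof.
pose o k : 'I_(r + 2) := insubd (Ordinal (ltn_addl r (isT : 0 < 2))) k.
have oE k : k < r + 2 -> val (o k) = k by move=> lt; rewrite val_insubd lt.
have [v0 v1 vr vr1] : [/\ val (o 0) = 0, val (o 1) = 1, val (o r) = r & val (o r.+1) = r.+1].
  by split; apply: oE; clear -r5; lia.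
have U : uniq [:: o 0; o r; o 1; o r.+1].
  by rewrite -(map_inj_uniq val_inj) /= v0 v1 vr vr1 !inE; clear -r5; lia.
have := card_triples_meeting _ setT _ _ _ _ U (fun x _ => in_setT x).
rewrite cardsT card_ord (_ : 4 * (r + 2) - 12 = 4 * r - 4); last by clear; lia.
move=> <-; rewrite -(card_imset _ (inv_inj (@setCK 'I_(r + 2)))).
apply/subset_leq_card/subsetP=> _ /imsetP[X + ->].
rewrite !inE subsetT /= => /and3P[/eqP cX h0 h1].
have -> : #|~: X| == r.-1 by rewrite cardsCs setCK card_ord cX; clear -r5; lia.
apply/cliqueP.
(* Equal residues with i < j force j = i + r with i = 0 or 1, a part that [X] meets. *)
have wlog_lt (i j : 'I_(r + 2)) : i \notin X -> j \notin X -> (i < j)%N -> turan (r + 2) r i j.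
  move=> iX jX ij; apply/negP => /eqP eq.
  have [lt_i lt_j] := (ltn_ord i, ltn_ord j).
  have jr : r <= j.
    rewrite leqNgt; apply/negP=> jr; have ir := ltn_trans ij jr.
    by move: eq ij; rewrite !modn_small // => ->; rewrite ltnn.
  have ej : j %% r = j - r.
    by rewrite -{1}(subnK jr) modnDr modn_small //; move: lt_j r5; clear; lia.
  have ir : i < r.
    rewrite ltnNge; apply/negP=> ri; move: eq; rewrite ej -{1}(subnK ri) modnDr modn_small.
      by move: ri jr ij; clear; lia.
    by move: lt_i r5; clear; lia.
  rewrite ej modn_small // in eq.
  have [j0|j1] : nat_of_ord j = r \/ nat_of_ord j = r.+1 by move: jr lt_j; clear; lia.
    have ei : i = o 0 by apply: val_inj; rewrite v0 /= eq j0 subnn.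
    have ejj : j = o r by apply: val_inj; rewrite vr.
    by move: h0; rewrite -ei -ejj (negPf iX) (negPf jX).
  have ei : i = o 1 by apply: val_inj; rewrite v1 /= eq j1 subSnn.
  have ejj : j = o r.+1 by apply: val_inj; rewrite vr1.
  by move: h1; rewrite -ei -ejj (negPf iX) (negPf jX).
move=> i j; rewrite !inE => iX jX ij; case: (ltngtP i j) => [lt|lt|/val_inj eq].
- exact: wlog_lt.
- by rewrite (proj1 turan_simple); apply: wlog_lt.
- by rewrite eq eqxx in ij.
Qed.

End Turan.

(* f_{r-1}(r+1, r) = rho_{r-1}(T(r+2,r)) = (4r-4)/(r+2), expressed as:
   the value (4r-4)/(r+2) bounds rho_{r-1} on the class G(r+1, r), and it is
   attained by T(r+2,r), which belongs to the class. *)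
Theorem mainTheorem14 (r : nat) (hr : (5 <= r)%N) :
  (forall (T : finType) (e : rel T),
      simple_graph e -> in_class e r.+1 r -> (0 < #|T|)%N ->
      (rho e r.-1 <= (4 * r - 4)%N%:R / (r + 2)%N%:R :> rat)%R)
  /\ simple_graph (turan (r + 2) r)
  /\ in_class (turan (r + 2) r) r.+1 r
  /\ rho (turan (r + 2) r) r.-1 = ((4 * r - 4)%N%:R / (r + 2)%N%:R :> rat)%R.
Proof.
have sg := turan_simple r; have ic := turan_in_class r hr.
split; [by move=> T e; apply: rho_le|do 2!split=> //].
apply/eqP; rewrite eq_le rho_le ?card_ord //=; last by rewrite addn2.
by rewrite /rho card_ord ler_pM2r ?invr_gt0 ?ltr0n ?ler_nat ?kt_turan_ge // addn2.
Qed.
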